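(* Let $X$ and $Y$ be random variables on a probability space $(\Omega,\mathcal{F},\mathbb{P})$ taking values in Polish spaces $(\mathbb{S}_1,\rho_1)$ and $(\mathbb{S}_2,\rho_2)$, respectively. If the law of $Y$ is atomless, then for every $\epsilon>0$ there exists a random variable $Z$ with values in $\mathbb{S}_2$ such that $\mathrm{Law}(Z)=\mathrm{Law}(Y)$, $\rho_2(Y,Z)\le\epsilon$ a.s., and $X$ is $Z$-measurable, i.e. $X=f(Z)$ a.s. for some Borel function $f:\mathbb{S}_2\to\mathbb{S}_1$. *)

(* Defs.v *)
From HB Require Import structures.
From mathcomp Require Import all_boot all_order all_algebra.
From mathcomp Require Import all_classical all_reals all_analysis.
Set Implicit Arguments. Unset Strict Implicit. Unset Printing Implicit Defensive.
Import Order.TTheory GRing.Theory Num.Theory.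
Local Open Scope classical_set_scope.
Local Open Scope ring_scope.

Section Polish.
Variables (R : realType) (T : Type) (rho : T -> T -> R).

Definition is_metric : Prop :=
  [/\ (forall x y, 0 <= rho x y),
      (forall x y, rho x y = 0 <-> x = y),
      (forall x y, rho x y = rho y x) &
      (forall x y z, rho x z <= rho x y + rho y z)].

Definition metric_cauchy (u : nat -> T) : Prop :=
  forall e, 0 < e -> exists N : nat,
    forall m n, (N <= m)%N -> (N <= n)%N -> rho (u m) (u n) < e.

Definition metric_converges (u : nat -> T) (x : T) : Prop :=
  forall e, 0 < e -> exists N : nat, forall n, (N <= n)%N -> rho (u n) x < e.

Definition metric_complete : Prop :=
  forall u, metric_cauchy u -> exists x, metric_converges u x.

Definition metric_separable : Prop :=
  exists D : set T, countable D /\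
    forall x e, 0 < e -> exists2 y, D y & rho x y < e.

Definition polish : Prop := [/\ is_metric, metric_complete & metric_separable].

Definition metric_open (U : set T) : Prop :=
  forall x, U x -> exists2 e, 0 < e & forall y, rho x y < e -> U y.

Definition borel_sets : set (set T) := <<s metric_open >>.

End Polish.

Definition random_var (R : realType) (d : measure_display) (Omega : measurableType d)
  (S : Type) (rho : S -> S -> R) (X : Omega -> S) : Prop :=
  forall B, borel_sets rho B -> measurable (X @^-1` B).

Definition borel_fun (R : realType) (S S' : Type) (rho : S -> S -> R)
  (rho' : S' -> S' -> R) (f : S -> S') : Prop :=
  forall B, borel_sets rho' B -> borel_sets rho (f @^-1` B).

Definition same_law (R : realType) (d : measure_display) (Omega : measurableType d)
  (P : probability Omega R) (S : Type) (rho : S -> S -> R) (Z Y : Omega -> S) : Prop :=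
  forall B, borel_sets rho B -> P (Z @^-1` B) = P (Y @^-1` B).

Definition atomless_law (R : realType) (d : measure_display) (Omega : measurableType d)
  (P : probability Omega R) (S : Type) (Y : Omega -> S) : Prop :=
  forall y : S, P (Y @^-1` [set y]) = 0%E.

(* Main.v *)
Require Import Defs.
From HB Require Import structures.
From mathcomp Require Import all_boot all_order all_algebra.
From mathcomp Require Import all_classical all_reals all_analysis.
From mathcomp Require Import measurable_realfun ring lra.
Set Implicit Arguments.
Unset Strict Implicit.
Unset Printing Implicit Defensive.
Import Order.TTheory GRing.Theory Num.Theory.
Import numFieldNormedType.Exports.
Local Open Scope classical_set_scope.
Local Open Scope ring_scope.

(* A Polish space embeds into the real line: a point is recorded by the bits "lies
   in the ball of radius 2^-k about the j-th point of a dense sequence", and the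
   bits are the ternary digits of a real number. Completeness gives a Borel
   decoder defined on all reals. Partition S2 into countably many cells of radius
   eps / 2 and put the index of the cell of Y in the integer part of two real codes,
   W of Y and V of (X, Y). Both laws are atomless, and V, W have the same
   distribution function at the integers. The monotone rearrangement W' of V onto
   the law of W is therefore a.s. invertible, with V a function of W', and stays
   in the unit interval of V. Decoding W' gives Z: it has the law of Y, lies in the
   cell of Y, and determines V, hence X. *)

(** * Monotone transport between atomless laws on the line *)

Section quantile_transport.
Context (d : measure_display) (T : measurableType d) (R : realType).
Variable P : probability T R.
Implicit Types (X Y : {RV P >-> R}) (u v r s : R).

Definition Rcdf X r : R := fine (cdf X r).

Definition atomless_RV X := forall r, P (X @^-1` [set r]) = 0%E.

Lemma EFin_Rcdf X r : (Rcdf X r)%:E = P [set t | X t <= r].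
Proof.
by rewrite fineK ?fin_num_measure//; congr (P _).
Qed.

Lemma measurable_le_RV X r : measurable [set t | X t <= r].
Proof.
rewrite (_ : mkset _ = X @^-1` `]-oo, r]); first exact: measurable_funPTI.
by apply/seteqP; split => t; rewrite /= in_itv.
Qed.

Lemma Rcdf_nondecreasing X : nondecreasing_fun (Rcdf X).
Proof.
by move=> r s rs; rewrite fine_le ?fin_num_measure//; exact: cdf_nondecreasing.
Qed.

Lemma Rcdf_measurable X : measurable_fun setT (Rcdf X).
Proof.
by apply: nondecreasing_measurable => // r s rs; exact: Rcdf_nondecreasing.
Qed.

(** The increment over []a - 1/(n+1), a + 1/(n+1)]] is the probability of [F n]. These events
    decrease to the null event [X = a], and monotonicity passes from this sequence to all nearby
    points. *)
Lemma Rcdf_continuous X : atomless_RV X -> continuous (Rcdf X).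
Proof.
move=> X0 a.
pose F n := [set t | X t <= a + n.+1%:R^-1] `\` [set t | X t <= a - n.+1%:R^-1].
have mF n : measurable (F n) by apply: measurableD; exact: measurable_le_RV.
have FE n : P (F n) = (Rcdf X (a + n.+1%:R^-1) - Rcdf X (a - n.+1%:R^-1))%:E.
  rewrite EFinB !EFin_Rcdf measureD.
  - congr (_ - P _)%E; apply/seteqP; split => [t []//|t /= h]; split => //.
    by rewrite (le_trans h)// lerD2l (@le_trans _ _ 0)// oppr_le0.
  - exact: measurable_le_RV.
  - exact: measurable_le_RV.
  - by rewrite ltey_eq fin_num_measure//; exact: measurable_le_RV.
have cF : P (F n) @[n --> \oo] --> P (\bigcap_n F n).
  apply: nonincreasing_cvg_mu => //.
  - by rewrite ltey_eq fin_num_measure.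
  - exact: bigcap_measurable.
  - move=> m n mn; apply/subsetPset => t [/= h1 h2]; split => /=.
      by rewrite (le_trans h1)// lerD2l lef_pV2 ?posrE// ler_nat.
    move=> h; apply: h2; rewrite (le_trans h)// lerD2l lerN2.
    by rewrite lef_pV2 ?posrE// ler_nat.
have F0 : \bigcap_n F n = X @^-1` [set a].
  apply/seteqP; split => [t Ft|t /= Xa n _].
    apply/eqP; rewrite eq_le; apply/andP; split; apply/ler_addgt0Pr => e e0.
      have [N _ /(_ N (leqnn _)) /= Ne] := near_infty_natSinv_lt (PosNum e0).
      have [/= /le_trans + _] := Ft N I; apply.
      by rewrite lerD2l ltW.
    have [N _ /(_ N (leqnn _)) /= Ne] := near_infty_natSinv_lt (PosNum e0).
    have [_ /= /negP] := Ft N I; rewrite -ltNge ltrBlDr => /ltW /le_trans; apply.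
    by rewrite lerD2l ltW.
  split => /=; first by rewrite Xa lerDl.
  by apply/negP; rewrite Xa -ltNge ltrBlDr ltrDl.
have {cF} cF : Rcdf X (a + n.+1%:R^-1) - Rcdf X (a - n.+1%:R^-1) @[n --> \oo] --> 0.
  have /fine_cvg : P (F n) @[n --> \oo] --> 0%:E by rewrite F0 X0 in cF.
  by under eq_fun do rewrite FE.
apply/cvgrPdist_lt => e e0.
have /cvgrPdist_lt/(_ _ e0)[N _ /(_ N (leqnn _)) /= Ne] := cF.
near=> x.
have xN : `|a - x| <= N.+1%:R^-1.
  near: x; apply: cvgr_dist_le => //; exact: cvg_id.
move: xN; rewrite ler_norml => /andP[x1 x2].
have /(@Rcdf_nondecreasing X) h1 : x <= a + N.+1%:R^-1.
  by rewrite -lerBlDl -opprB lerNl.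
have /(@Rcdf_nondecreasing X) h2 : a - N.+1%:R^-1 <= x.
  by rewrite lerBlDl -lerBlDr.
have /(@Rcdf_nondecreasing X) h3 : a <= a + N.+1%:R^-1 by rewrite lerDl.
have /(@Rcdf_nondecreasing X) h4 : a - N.+1%:R^-1 <= a.
  by rewrite lerBlDr lerDl.
move: Ne; rewrite sub0r normrN ltr_norml => /andP[_ Ne].
by rewrite ltr_norml; apply/andP; split; lra.
Unshelve. all: by end_near. Qed.

Lemma Rcdf_onto X u : atomless_RV X -> 0 < u < 1 -> exists r, Rcdf X r = u.
Proof.
move=> X0 /andP[u0 u1].
have [a Fa] : exists a, Rcdf X a < u.
  have /fine_cvg /cvgrPdist_lt/(_ _ u0)[M [_ /(_ (M - 1))]] := cvg_cdfNy0 X.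
  rewrite sub0r normrN gtrBl ltr01 => /(_ isT) h; exists (M - 1).
  by rewrite (le_lt_trans _ h)// ler_norm.
have [b Fb] : exists b, u < Rcdf X b.
  have u1' : 0 < 1 - u by rewrite subr_gt0.
  have /fine_cvg /cvgrPdist_lt/(_ _ u1')[M [_ /(_ (M + 1))]] := cvg_cdfy1 X.
  rewrite ltrDl ltr01 => /(_ isT); rewrite ltr_norml => /andP[_ h].
  by exists (M + 1); rewrite /Rcdf; move: h; rewrite /= -/(Rcdf _ _); lra.
have ab : a <= b.
  by rewrite leNgt; apply/negP => /ltW /(@Rcdf_nondecreasing X) ?; lra.
have [||c _ <-] := @IVT _ (Rcdf X) a b u ab; last by exists c.
  exact/continuous_subspaceT/Rcdf_continuous.
by rewrite ge_min le_max (ltW Fa) (ltW Fb) orbT.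
Qed.

Lemma measurable_Rcdf_le X u : measurable [set t | Rcdf X (X t) <= u].
Proof.
have mf : measurable_fun setT (Rcdf X \o X).
  by apply: measurableT_comp => //; exact: Rcdf_measurable.
rewrite -[S in measurable S]setTI.
exact: (mf measurableT _ (measurable_itv `]-oo, u])).
Qed.

(** The probability integral transform. If [Rcdf X r = v > u], then [Rcdf X (X t) <= u] forces
    [X t <= r], so the probability is at most [v]; a point at level [u] itself gives the lower
    bound. *)
Lemma Rcdf_uniform X u : atomless_RV X -> 0 < u < 1 ->
  P [set t | Rcdf X (X t) <= u] = u%:E.
Proof.
move=> X0 u01; apply/eqP; rewrite eq_le; apply/andP; split.
  apply/lee_addgt0Pr => e e0; case/andP: u01 => u0 u1.
  (* The second argument of the minimum keeps [v] below 1, so that the level [v] is attained. *)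
  pose v := Num.min (u + e) ((u + 1) / 2).
  have uv : u < v by rewrite lt_min; apply/andP; split; lra.
  have v1 : v < 1 by rewrite gt_min; apply/orP; right; lra.
  have v01 : 0 < v < 1 by apply/andP; split; lra.
  have [r Fr] := @Rcdf_onto X v X0 v01.
  apply: (@le_trans _ _ v%:E); last by rewrite -EFinD lee_fin ge_min lexx.
  rewrite -Fr EFin_Rcdf; apply: le_measure; rewrite ?inE.
  - exact: measurable_Rcdf_le.
  - exact: measurable_le_RV.
  - move=> t /= h; rewrite leNgt; apply/negP => /ltW /(@Rcdf_nondecreasing X).
    by rewrite Fr; lra.
have [r Fr] := @Rcdf_onto X u X0 u01.
rewrite -{1}Fr EFin_Rcdf; apply: le_measure; rewrite ?inE.
- exact: measurable_le_RV.
- exact: measurable_Rcdf_le.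
- by move=> t /= /(@Rcdf_nondecreasing X); rewrite Fr.
Qed.

(** By the uniform law the level set lies in an event of probability at most [e]: a slab of width
    [f] ending at [u], or a tail of mass [f] when [u <= f] or [1 <= u]. *)
Lemma Rcdf_level_negligible X u : atomless_RV X ->
  P.-negligible [set t | Rcdf X (X t) = u].
Proof.
move=> X0.
have mE : measurable [set t | Rcdf X (X t) = u].
  have mf : measurable_fun setT (Rcdf X \o X).
    by apply: measurableT_comp => //; exact: Rcdf_measurable.
  rewrite -[S in measurable S]setTI.
  exact: (mf measurableT [set u] (measurable_set1 u)).
apply/negligibleP => //; apply/eqP; rewrite eq_le measure_ge0 andbT.
apply/lee_addgt0Pr => e e0; rewrite add0e.
pose f := Num.min (e / 2) (1 / 4).
have f0 : 0 < f by rewrite lt_min; apply/andP; split; lra.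
have fe : f <= e / 2 by rewrite ge_min lexx.
have f1 : f <= 1 / 4 by rewrite ge_min lexx orbT.
have [u1|u1] := leP 1 u.
  have f01 : 0 < 1 - f < 1 by apply/andP; split; lra.
  apply: (@le_trans _ _ (P (~` [set t | Rcdf X (X t) <= 1 - f]))).
    apply: le_measure; rewrite ?inE//.
      by apply: measurableC; exact: measurable_Rcdf_le.
    by move=> t /= ->; apply/negP; rewrite -ltNge; lra.
  rewrite probability_setC; last exact: measurable_Rcdf_le.
  by rewrite Rcdf_uniform// -EFinB lee_fin; lra.
have [u0|u0] := leP u f.
  have f01 : 0 < f < 1 by apply/andP; split; lra.
  apply: (@le_trans _ _ (P [set t | Rcdf X (X t) <= f])).
    apply: le_measure; rewrite ?inE//; first exact: measurable_Rcdf_le.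
    by move=> t /= ->.
  by rewrite Rcdf_uniform// lee_fin; lra.
have u01 : 0 < u < 1 by apply/andP; split; lra.
have f01 : 0 < u - f < 1 by apply/andP; split; lra.
apply: (@le_trans _ _
  (P ([set t | Rcdf X (X t) <= u] `\` [set t | Rcdf X (X t) <= u - f]))).
  apply: le_measure; rewrite ?inE//.
    by apply: measurableD; exact: measurable_Rcdf_le.
  by move=> t /= ->; split => //; apply/negP; rewrite -ltNge; lra.
set D := _ `\` _; have -> : P D = (u%:E - (u - f)%:E)%E.
  rewrite measureD; [|exact: measurable_Rcdf_le|exact: measurable_Rcdf_le|].
    rewrite setIidr; last by move=> t /= h; lra.
    by congr (_ - _)%E; exact: Rcdf_uniform.
  by rewrite ltey_eq fin_num_measure//; exact: measurable_Rcdf_le.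
by rewrite -EFinB lee_fin; lra.
Qed.

(* Only the values on the open unit interval matter; elsewhere the infimum could
   be over an empty or unbounded set. *)
Definition quantile X u : R :=
  if 0 < u < 1 then inf [set r | u <= Rcdf X r] else 0.

Lemma has_lbound_Rcdf_ge X u : atomless_RV X -> 0 < u < 1 ->
  has_lbound [set r | u <= Rcdf X r].
Proof.
move=> X0 /andP[u0 u1].
have [|s Fs] := @Rcdf_onto X (u / 2) X0; first by apply/andP; split; lra.
exists s => q /= uq; rewrite leNgt; apply/negP => /ltW.
by move=> /(@Rcdf_nondecreasing X); lra.
Qed.

(** The infimum is at most a point of level [u], so its own level is at most [u]. It is also a limit
    of points of level at least [u], and continuity gives the converse. *)
Lemma Rcdf_quantile X u : atomless_RV X -> 0 < u < 1 ->
  Rcdf X (quantile X u) = u.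
Proof.
move=> X0 u01; rewrite /quantile u01; set E := mkset _.
have [r Fr] := @Rcdf_onto X u X0 u01.
have Er : E r by rewrite /E /= Fr.
have lbE : has_lbound E by exact: has_lbound_Rcdf_ge.
apply/eqP; rewrite eq_le; apply/andP; split.
  by rewrite -[leRHS]Fr; apply: Rcdf_nondecreasing; exact: ge_inf.
apply/ler_addgt0Pr => e e0.
have /cvgrPdist_lt/(_ _ e0)[f /= f0 fB] := @Rcdf_continuous X X0 (inf E).
have [|q Eq qE] := @inf_adherent _ E f f0; first by split => //; exists r.
have Eq' : inf E <= q by exact: ge_inf.
have := fB q; rewrite /ball_ /= ltr_norml ltr_norml => /(_ _)/wrap[].
  by apply/andP; split; lra.
by move=> /andP[h _]; move: Eq; rewrite /E /=; lra.
Qed.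

(** The Galois connection to which the measurability of quantiles and the properties of the
    transport are reduced. *)
Lemma quantile_le X u r : atomless_RV X -> 0 < u < 1 ->
  (quantile X u <= r) = (u <= Rcdf X r).
Proof.
move=> X0 u01; apply/idP/idP => [/(@Rcdf_nondecreasing X)|ur].
  by rewrite Rcdf_quantile.
by rewrite /quantile u01; apply: ge_inf => //; exact: has_lbound_Rcdf_ge.
Qed.

Lemma quantile_measurable X : atomless_RV X -> measurable_fun setT (quantile X).
Proof.
(* Repeating the test isolates the open unit interval, where the preimage of []r, +oo[] is cut out
   by []Rcdf X r, +oo[]. *)
move=> X0; rewrite (_ : quantile X = (fun u =>
    if 0 < u < 1 then quantile X u else 0)); last first.
  by apply/funext => u; rewrite /quantile; case: ifP.
have mI : measurable_fun setT (fun u : R => 0 < u < 1).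
  by apply: measurable_and; exact: measurable_fun_ltr.
apply: measurable_fun_if => //.
rewrite setTI (_ : _ @^-1` _ = `]0, 1[%classic); last first.
  by apply/seteqP; split => u /=; rewrite in_itv.
move=> _; apply: (measurability _ (RGenOInfty.measurableE R)) => //.
move=> _ [_ [r ->] <-].
rewrite (_ : _ `&` _ = `]0, 1[ `&` `]Rcdf X r, +oo[); first exact: measurableI.
apply/seteqP; split => u /=; rewrite !in_itv/= !andbT => -[u01 h]; split => //.
  by rewrite ltNge -(quantile_le _ X0)// -ltNge.
by rewrite ltNge (quantile_le _ X0)// -ltNge.
Qed.

Lemma ae_le_measure (A B : set T) : measurable A -> measurable B ->
  {ae P, forall t, A t -> B t} -> (P A <= P B)%E.
Proof.
move=> mA mB [N [mN N0 sN]].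
rewrite -(measureU0 mB mN N0); apply: le_measure; rewrite ?inE//.
  exact: measurableU.
move=> t At; have [Bt|nBt] := pselect (B t); [by left|right].
by apply: sN => /= /(_ At).
Qed.

Lemma ae_eq_measure (A B : set T) : measurable A -> measurable B ->
  {ae P, forall t, A t <-> B t} -> P A = P B.
Proof.
move=> mA mB AB; apply/eqP; rewrite eq_le.
by apply/andP; split; apply: ae_le_measure => //; apply: filterS AB => t [].
Qed.

Lemma eq_law_le X Y : (forall r, P [set t | X t <= r] = P [set t | Y t <= r]) ->
  forall B, measurable B -> P (X @^-1` B) = P (Y @^-1` B).
Proof.
move=> XY B mB.
have gtE (Z : {RV P >-> R}) r :
    P (Z @^-1` `]r, +oo[) = (1 - P [set t | (Z t <= r)%R])%E.
  rewrite -probability_setC; last exact: measurable_le_RV.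
  congr (P _); apply/seteqP; split => t /=; rewrite in_itv/= andbT ltNge.
    by move/negP.
  by move=> /negP.
apply: (@measure_unique _ _ _ (@RGenOInfty.G R)
  (fun n => `](- n%:R), +oo[%classic) _ _ _ _
  (distribution P X) (distribution P Y)) => //.
- exact: RGenOInfty.measurableE.
- move=> _ _ [a ->] [b ->]; exists (Num.max a b).
  by apply/seteqP; split => r; rewrite /= !in_itv/= !andbT gt_max => /andP.
- by move=> n; exists (- n%:R).
- apply/seteqP; split => // r _; exists (Num.truncn (- r)).+1 => //=.
  by rewrite in_itv/= andbT ltrNl truncnS_gt.
- by move=> _ [r ->]; rewrite /= /distribution /pushforward !gtE XY.
- by move=> n; rewrite ltey_eq fin_num_measure.
Qed.

Lemma ae_Rcdf_itv X : atomless_RV X -> {ae P, forall t, 0 < Rcdf X (X t) < 1}.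
Proof.
move=> X0; apply: (@negligibleS _ _ _ _ ([set t | Rcdf X (X t) = 0] `|`
    [set t | Rcdf X (X t) = 1])).
  move=> t /= /negP; rewrite negb_and -!leNgt => /orP[h|h]; [left|right].
    by apply/eqP; rewrite eq_le h /Rcdf fine_ge0// cdf_ge0.
  apply/eqP; rewrite eq_le h andbT -lee_fin EFin_Rcdf probability_le1//.
  exact: measurable_le_RV.
by apply: negligibleU; exact: Rcdf_level_negligible.
Qed.

Lemma Rcdf_uniform_closed X u : atomless_RV X -> 0 <= u <= 1 ->
  P [set t | Rcdf X (X t) <= u] = u%:E.
Proof.
move=> X0; rewrite !le_eqVlt => /andP[/predU1P[<- _|u0 /predU1P[->|u1]]].
- apply: etrans (measure0 P); apply: ae_eq_measure => //.
    exact: measurable_Rcdf_le.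
  by apply: filterS (ae_Rcdf_itv X0) => t /andP[t0 _]; split=> //=; lra.
- apply: etrans (probability_setT P); apply: ae_eq_measure => //.
    exact: measurable_Rcdf_le.
  by apply: filterS (ae_Rcdf_itv X0) => t /andP[_ t1]; split=> //= _; exact: ltW.
- by apply: Rcdf_uniform; rewrite ?u0.
Qed.

(** * The increasing rearrangement of one variable onto the law of another *)

Definition transport X Y : T -> R := quantile Y \o Rcdf X \o X.

Lemma transport_measurable X Y : atomless_RV Y ->
  measurable_fun setT (transport X Y).
Proof.
move=> Y0; apply: measurableT_comp => //.
by apply: measurableT_comp; [exact: quantile_measurable|exact: Rcdf_measurable].
Qed.

(** Almost surely [transport X Y t <= r] means [Rcdf X (X t) <= Rcdf Y r], and [Rcdf X (X t)] is
    uniform. *)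
Lemma transport_law X Y : atomless_RV X -> atomless_RV Y ->
  forall B, measurable B -> P (transport X Y @^-1` B) = P (Y @^-1` B).
Proof.
move=> X0 Y0.
pose Z : {RV P >-> R} := HB.pack (transport X Y)
  (isMeasurableFun.Build _ _ _ _ (transport X Y) (transport_measurable X Y0)).
apply: (@eq_law_le Z Y) => r.
have Yr : 0 <= Rcdf Y r <= 1.
  rewrite /Rcdf fine_ge0//= -lee_fin EFin_Rcdf probability_le1//.
  exact: measurable_le_RV.
rewrite -(EFin_Rcdf Y) -(Rcdf_uniform_closed X0 Yr).
apply: ae_eq_measure; [exact: (measurable_le_RV Z)|exact: measurable_Rcdf_le|].
by apply: filterS (ae_Rcdf_itv X0) => t t01; rewrite /Z /= quantile_le.
Qed.

(** Failure places [X t] strictly to the right of the first point of its level. A rational [q] lies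
    between the two, so [Rcdf X (X t)] is one of the countably many levels [Rcdf X (ratr q)], each
    null. Indices coding no rational get the level 0, which is null as well. *)
Lemma quantile_Rcdf X : atomless_RV X ->
  {ae P, forall t, quantile X (Rcdf X (X t)) = X t}.
Proof.
move=> X0; pose F n := [set t | Rcdf X (X t) =
  (if unpickle n is Some q then Rcdf X (ratr q) else 0)].
apply: (@negligibleS _ _ _ _ ([set t | ~ 0 < Rcdf X (X t) < 1] `|`
    \bigcup_n F n)).
  move=> t /= tX; have [t01|] := boolP (0 < Rcdf X (X t) < 1); last first.
    by move=> /negP; left.
  right; have : quantile X (Rcdf X (X t)) < X t.
    by rewrite lt_neqAle quantile_le// lexx andbT; exact/eqP.
  move=> /rat_in_itvoo[q]; rewrite in_itv/= => /andP[q1 q2].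
  exists (pickle q) => //; rewrite /F /= pickleK; apply/eqP; rewrite eq_le.
  rewrite -(quantile_le _ X0 t01) ltW//=.
  by apply: Rcdf_nondecreasing; exact: ltW.
apply: negligibleU; first exact: ae_Rcdf_itv.
by apply: negligible_bigcup => n; exact: Rcdf_level_negligible.
Qed.

Lemma transportK X Y : atomless_RV X -> atomless_RV Y ->
  {ae P, forall t, quantile X (Rcdf Y (transport X Y t)) = X t}.
Proof.
move=> X0 Y0; apply: filterS2 (ae_Rcdf_itv X0) (quantile_Rcdf X0) => t t01 tX.
by rewrite /transport /= Rcdf_quantile.
Qed.

(** Where the two distribution functions agree, the transport does not cross [r]: off the null level
    of [r], [X t <= r] is equivalent to [Rcdf X (X t) <= Rcdf X r]. *)
Lemma transport_le X Y r : atomless_RV X -> atomless_RV Y ->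
  Rcdf X r = Rcdf Y r -> {ae P, forall t, (transport X Y t <= r) = (X t <= r)}.
Proof.
move=> X0 Y0 XY.
have lvl : {ae P, forall t, Rcdf X (X t) <> Rcdf X r}.
  by apply: negligibleS (Rcdf_level_negligible (Rcdf X r) X0) => t /= /contrapT.
apply: filterS2 (ae_Rcdf_itv X0) lvl => t t01 tr.
rewrite /transport /= quantile_le// -XY; apply/idP/idP => [h|].
  rewrite leNgt; apply/negP => /ltW /(@Rcdf_nondecreasing X) h'.
  by apply: tr; apply/eqP; rewrite eq_le h.
exact: Rcdf_nondecreasing.
Qed.

End quantile_transport.

(** * Coding bits by real numbers *)

Section least.

(** The default 0, when no bit is set, lets [approx] run on arbitrary arrays of bits. *)
Definition least (p : nat -> bool) : nat :=
  if pselect (exists n, p n) is left e then ex_minn e else 0.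

Lemma leastP (p : nat -> bool) : (exists n, p n) -> p (least p).
Proof. by move=> e; rewrite /least; case: pselect => // e'; case: ex_minnP. Qed.

Lemma leastE (p : nat -> bool) n :
  p n -> (forall i, (i < n)%N -> ~~ p i) -> least p = n.
Proof.
move=> pn pi; rewrite /least; case: pselect => [e|[]]; last by exists n.
case: ex_minnP => m pm /(_ _ pn) mn; apply/eqP; rewrite eqn_leq mn /=.
by rewrite leqNgt; apply/negP => /pi /negP.
Qed.

Lemma least_eq (p : nat -> bool) n : least p = n <->
  (p n /\ forall i, (i < n)%N -> ~~ p i) \/ (n = 0%N /\ forall i, ~~ p i).
Proof.
split=> [|[[pn pi]|[-> pi]]]; last 2 first.
- exact: leastE.
- by rewrite /least; case: pselect => // e; case: ex_minnP => i;
  rewrite (negbTE (pi i)).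
rewrite /least; case: pselect => [e|ne].
  case: ex_minnP => m pm mle <-; left; split => // i im.
  by apply/negP => /mle; rewrite leqNgt im.
by move=> <-; right; split => // i; apply/negP => pi; apply: ne; exists i.
Qed.

Context (d : measure_display) (T : measurableType d).

Lemma measurable_nat_preimage (f : T -> nat) (A : set nat) :
  (forall n, measurable [set t | f t = n]) -> measurable [set t | A (f t)].
Proof.
move=> mf; rewrite (_ : mkset _ = \bigcup_(n in A) [set t | f t = n]).
  exact: bigcup_measurable.
apply/seteqP; split => [t At|t [n An /= ftn]]; first by exists (f t).
by rewrite /= ftn.
Qed.

(** Serves the recursion of [approx], whose next value depends on the previous one and on a new
    candidate. *)
Lemma measurable_nat_comp2 (F : nat -> nat -> nat) (f g : T -> nat) n :
  (forall n, measurable [set t | f t = n]) ->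
  (forall n, measurable [set t | g t = n]) ->
  measurable [set t | F (f t) (g t) = n].
Proof.
move=> mf mg; rewrite (_ : mkset _ = \bigcup_m
    ([set t | f t = m] `&` [set t | F m (g t) = n])).
  apply: bigcup_measurable => m _; apply: measurableI => //.
  exact: (measurable_nat_preimage (fun k => F m k = n)).
apply/seteqP; split => [t At|t [m _ [/= ft gt]]]; first by exists (f t).
by rewrite /= ft.
Qed.

Lemma measurable_least (p : T -> nat -> bool) n :
  (forall j, measurable [set t | p t j]) -> measurable [set t | least (p t) = n].
Proof.
move=> mp; have mnp j : measurable [set t | ~~ p t j].
  rewrite (_ : mkset _ = ~` [set t | p t j]); first exact: measurableC.
  by apply/seteqP; split => t /=; move/negP.
rewrite (_ : mkset _ =
    ([set t | p t n] `&` \bigcap_(i in [set i | (i < n)%N]) [set t | ~~ p t i])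
    `|` (if n == 0%N then \bigcap_i [set t | ~~ p t i] else set0)).
  apply: measurableU; first apply: measurableI => //.
    have [->|n0] := eqVneq n 0%N.
      by rewrite (_ : mkset _ = set0) ?bigcap_set0//; apply/seteqP; split.
    by apply: bigcap_measurable => //; exists 0%N; rewrite /= lt0n.
  by case: ifP => // _; exact: bigcap_measurableType.
apply/seteqP; split => t /=.
  move=> /least_eq[[pn pi]|[-> pi]]; [left; split => // i /pi//|right].
  by rewrite eqxx => i _ /=; exact: pi.
move=> [[pn pi]|+]; [|case: ifP => // /eqP -> h]; apply/least_eq.
  by left; split => // i /pi.
by right; split => // i; exact: h.
Qed.

End least.

(** * Ternary expansions with digits 0 and 1 *)

Section bit_coding.
Variable R : realType.
Implicit Types (b : nat -> bool) (r : R).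

(** The partial sum of [b i / 3^(i+1)] over [i < n], in Horner form so that the first digit can be
    peeled off. *)
Fixpoint ternary_part (n : nat) b : R :=
  if n is m.+1 then ((b 0%N)%:R + ternary_part m (b \o succn)) / 3 else 0.

Lemma ternary_part_itv n b : 0 <= ternary_part n b <= 2^-1.
Proof.
elim: n b => [|n ih] b /=; first by rewrite lexx invr_ge0 ler0n.
have /andP[h1 h2] := ih (b \o succn).
by case: (b 0%N) => /=; apply/andP; split; lra.
Qed.

Lemma ternary_part_le b :
  {homo ternary_part ^~ b : m n / (m <= n)%N >-> m <= n}.
Proof.
move=> m n; elim: m n b => [|m ih] n b.
  by move=> _; have /andP[] := ternary_part_itv n b.
case: n => // n /(ih _ (b \o succn)) h /=.
by rewrite ler_pM2r ?invr_gt0// lerD2l.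
Qed.

Definition ternary b : R := limn (ternary_part ^~ b).

Lemma ternary_cvg b : ternary_part ^~ b @ \oo --> ternary b.
Proof.
apply: nondecreasing_is_cvgn; first exact: ternary_part_le.
by exists 2^-1 => _ [n _ <-]; have /andP[] := ternary_part_itv n b.
Qed.

Lemma ternary_itv b : 0 <= ternary b <= 2^-1.
Proof.
apply/andP; split.
  apply: limr_ge; first exact: ternary_cvg.
  by near=> n; have /andP[] := ternary_part_itv n b.
apply: limr_le; first exact: ternary_cvg.
by near=> n; have /andP[] := ternary_part_itv n b.
Unshelve. all: by end_near. Qed.

Lemma ternaryE b : ternary b = ((b 0%N)%:R + ternary (b \o succn)) / 3.
Proof.
apply/cvg_lim => //; rewrite -(cvg_shiftS (ternary_part ^~ b)) /=.
apply: cvgM; last exact: cvg_cst.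
by apply: cvgD; [exact: cvg_cst|exact: ternary_cvg].
Qed.

(** The tail of an expansion is at most 1/2, so a first bit 0 gives at most 1/6 and a first bit 1 at
    least 1/3: the threshold separates them. *)
Definition digit r : bool := 3^-1 <= r.

Definition shift r : R := 3 * r - (digit r)%:R.

Lemma digit_ternary b : digit (ternary b) = b 0%N.
Proof.
rewrite /digit ternaryE; have /andP[h1 h2] := ternary_itv (b \o succn).
by case: (b 0%N) => /=; [apply/idP; lra|apply/negbTE; rewrite -ltNge; lra].
Qed.

Lemma shift_ternary b : shift (ternary b) = ternary (b \o succn).
Proof. by rewrite /shift digit_ternary ternaryE; field. Qed.

Lemma ternaryK b n : digit (iter n shift (ternary b)) = b n.
Proof.
elim: n b => [|n ih] b; first exact: digit_ternary.
by rewrite iterSr shift_ternary ih.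
Qed.

Lemma measurable_ternary (d : measure_display) (T : measurableType d)
    (b : T -> nat -> bool) : (forall n, measurable [set t | b t n]) ->
  measurable_fun setT (fun t => ternary (b t)).
Proof.
move=> mb; apply: (@measurable_fun_cvg _ _ _ _ (fun n t => ternary_part n (b t))).
  move=> n; elim: n b mb => [|n ih] b mb /=; first exact: measurable_cst.
  apply: measurable_funM; last exact: measurable_cst.
  apply: measurable_funD; last first.
    by apply: (ih (fun t => b t \o succn)) => m; exact: mb.
  rewrite (_ : (fun _ => _) = \1_[set t | b t 0%N]).
    exact: measurable_indic.
  by apply/funext => t; rewrite indicE; congr (_%:R); rewrite mem_setE.
by move=> t _; exact: ternary_cvg.
Qed.

Lemma measurable_digit : measurable_fun setT digit.
Proof. by apply: measurable_fun_ler => //; exact: measurable_cst. Qed.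

Lemma measurable_shift : measurable_fun setT shift.
Proof.
apply: measurable_funB; first exact: measurable_funM.
rewrite (_ : (fun _ => _) = \1_[set r | digit r]).
  apply: measurable_indic; rewrite -[S in measurable S]setTI.
  by apply: (@measurable_digit measurableT [set true]).
by apply/funext => t; rewrite indicE; congr (_%:R); rewrite mem_setE.
Qed.

Lemma measurable_digit_iter n : measurable [set r | digit (iter n shift r)].
Proof.
have mi : measurable_fun setT (iter n shift).
  elim: n => [|n ih]; first exact: measurable_id.
  by apply: measurableT_comp => //; exact: measurable_shift.
have md : measurable_fun setT (digit \o iter n shift).
  by apply: measurableT_comp => //; exact: measurable_digit.
rewrite -[S in measurable S]setTI.
by apply: (md measurableT [set true]).
Qed.

End bit_coding.

(** * Real codes of an integer together with an array of bits *)

Section real_coding.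
Variables (R : realType) (I : countType).
Implicit Types (b : I -> bool) (r : R).

Definition flat b (n : nat) : bool := if unpickle n is Some i then b i else false.

(* The code of [(n, b)] lies in [n + 1/2, n + 1], so that comparing codes with
   integers compares the integer components. *)
Definition code (n : nat) b : R := n%:R + (2^-1 + ternary R (flat b)).

(** The intervals []n, n + 1]] are closed on the right to match events of the form [X <= r]; every
    [r <= 1] gets index 0. *)
Definition code_index r : nat := least (fun n => r <= n.+1%:R).

Definition decode r (i : I) : bool :=
  digit (iter (pickle i) (@shift R) (r - (code_index r)%:R - 2^-1)).

Lemma code_le n b m : (code n b <= m%:R) = (n < m)%N.
Proof.
rewrite /code; have /andP[h1 h2] := ternary_itv R (flat b).
have [nm|mn] := ltnP n m.
  move: nm; rewrite -(ler_nat R) -natr1 => nm; apply/idP; lra.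
by move: mn; rewrite -(ler_nat R) => mn; apply/negbTE; rewrite -ltNge; lra.
Qed.

Lemma code_indexK n b : code_index (code n b) = n.
Proof.
apply: leastE => [|i]; first by rewrite code_le.
by rewrite code_le -leqNgt.
Qed.

Lemma codeK n b : decode (code n b) = b.
Proof.
apply/funext => i; rewrite /decode code_indexK.
rewrite (_ : _ - _ - _ = ternary R (flat b)); last by rewrite /code; field.
by rewrite ternaryK /flat pickleK.
Qed.

Lemma measurable_natr (d : measure_display) (T : measurableType d)
    (f : T -> nat) : (forall n, measurable [set t | f t = n]) ->
  measurable_fun setT (fun t => (f t)%:R : R).
Proof.
move=> mf _ B mB; rewrite setTI.
exact: (@measurable_nat_preimage _ _ f (fun n => B n%:R)).
Qed.

Lemma measurable_code (d : measure_display) (T : measurableType d)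
    (f : T -> nat) (b : T -> I -> bool) :
  (forall n, measurable [set t | f t = n]) ->
  (forall i, measurable [set t | b t i]) ->
  measurable_fun setT (fun t => code (f t) (b t)).
Proof.
move=> mf mb; apply: measurable_funD; first exact: measurable_natr.
apply: measurable_funD; first exact: measurable_cst.
apply: measurable_ternary => n; rewrite /flat; case: (unpickle n) => [i|]; first exact: mb.
by rewrite (_ : mkset _ = set0)//; apply/seteqP; split.
Qed.

Lemma measurable_decode i : measurable [set r | decode r i].
Proof.
have mx : measurable_fun setT (fun r : R => r - (code_index r)%:R - 2^-1).
  apply: measurable_funB; last exact: measurable_cst.
  apply: measurable_funB; first exact: measurable_id.
  apply: measurable_natr => n; apply: measurable_least => j.
  by rewrite -set_itvNyc.
rewrite -[S in measurable S]setTI.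
exact: (mx measurableT _ (measurable_digit_iter (pickle i))).
Qed.

End real_coding.

(** * Coding points of a Polish space *)

Section polish_coding.
Variables (R : realType) (S : Type) (rho : S -> S -> R).
Hypothesis rho_polish : polish rho.

Lemma metric_refl x : rho x x = 0.
Proof. by case: rho_polish => -[_ h _ _] _ _; apply/h. Qed.

Lemma metric_sym x y : rho x y = rho y x.
Proof. by case: rho_polish => -[]. Qed.

Lemma metric_triangle y x z : rho x z <= rho x y + rho y z.
Proof. by case: rho_polish => -[]. Qed.

Lemma metric_eq x y : (forall e, 0 < e -> rho x y <= e) -> x = y.
Proof.
move=> xy; case: rho_polish => -[h0 h _ _] _ _; apply/h.
apply/eqP; rewrite eq_le h0 andbT; apply/ler_addgt0Pr => e e0.
by rewrite add0r xy.
Qed.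

Lemma metric_open_ball y e : metric_open rho [set x | rho x y < e].
Proof.
move=> x /= xy; exists (e - rho x y) => [|z xz]; first by rewrite subr_gt0.
by have := metric_triangle x z y; rewrite (metric_sym z x); lra.
Qed.

Lemma borel_set1 y : borel_sets rho [set y].
Proof.
suff : borel_sets rho (setT `\` [set x | x <> y]).
  rewrite setTD (_ : ~` _ = [set y])//.
  by apply/seteqP; split => x /=; [exact: contrapT|move=> ->].
apply: sigma_algebraCD; apply: sub_sigma_algebra => x /= xy.
exists (rho x y); last by move=> z + zy; rewrite zy ltxx.
case: rho_polish => -[h0 h _ _] _ _; rewrite lt_neqAle h0 andbT eq_sym.
by apply/eqP => /h.
Qed.

(** The countable dense set may be finite; [x0] fills the indices outside the image of its injection
    into the integers. *)
Lemma dense_sequence (x0 : S) :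
  exists u : nat -> S, forall x e, 0 < e -> exists n, rho x (u n) < e.
Proof.
case: rho_polish => _ _ [D [/countable_injP[f fI] De]].
have /choice[u uP] : forall n, exists y, forall x, D x -> f x = n -> x = y.
  move=> n; have [[y [Dy fy]]|nD] := pselect (exists y, D y /\ f y = n).
    by exists y => x Dx fx; apply: fI; rewrite ?inE// fx.
  by exists x0 => x Dx fx; exfalso; apply: nD; exists x.
exists u => x e e0; have [y Dy xy] := De x e e0.
by exists (f y); rewrite -(uP (f y) y).
Qed.

Lemma random_var_open (d : measure_display) (T : measurableType d) (f : T -> S) :
  (forall U, metric_open rho U -> measurable (f @^-1` U)) -> random_var rho f.
Proof.
move=> mf; apply: smallest_sub; last exact: mf.
split => [|A mA|A mA]; rewrite /=.
- by rewrite preimage_set0.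
- exact: (@measurableD _ _ setT (f @^-1` A)).
- by rewrite preimage_bigcup; exact: bigcup_measurable.
Qed.

Variable u : nat -> S.
Hypothesis u_dense : forall x e, 0 < e -> exists n, rho x (u n) < e.
Implicit Types b : nat * nat -> bool.

Definition ball_bits (x : S) (kj : nat * nat) : bool :=
  rho x (u kj.2) < 2^-1 ^+ kj.1.

(* A candidate that is too far from the previous approximation is ignored, so
   that the sequence is Cauchy for every array of bits. *)
Fixpoint approx b (k : nat) : nat :=
  if k is l.+1 then
    let j := least (fun j => b (k, j)) in
    if rho (u (approx b l)) (u j) < 2 * 2^-1 ^+ l then j else approx b l
  else least (fun j => b (0%N, j)).

Let half_gt0 k : 0 < 2^-1 ^+ k :> R.
Proof. by rewrite exprn_gt0// invr_gt0. Qed.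

Lemma approx_step b k : rho (u (approx b k)) (u (approx b k.+1)) <= 2 * 2^-1 ^+ k.
Proof.
by rewrite /=; case: ifP => [/ltW//|_]; rewrite metric_refl mulr_ge0// ltW.
Qed.

Lemma approx_dist b k n :
  rho (u (approx b k)) (u (approx b (k + n))) <= 4 * 2^-1 ^+ k.
Proof.
(* The strengthened bound is the exact sum of the step bounds [2 * 2^-l] for [k <= l < k + n], which
   makes the induction close. *)
suff : rho (u (approx b k)) (u (approx b (k + n))) <=
    4 * 2^-1 ^+ k - 4 * 2^-1 ^+ (k + n).
  by move/le_trans; apply; rewrite lerBlDr lerDl mulr_ge0// ltW.
elim: n => [|n ih]; first by rewrite addn0 subrr metric_refl.
rewrite addnS; apply: le_trans (metric_triangle (u (approx b (k + n))) _ _) _.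
have := approx_step b (k + n); rewrite exprS.
by move: ih; lra.
Qed.

Lemma half_small e : 0 < e -> exists k, 2^-1 ^+ k < e :> R.
Proof.
move=> e0; have [k _ /(_ k (leqnn _))] := near_infty_natSinv_expn_lt (PosNum e0).
by rewrite /= div1r -exprVn => ?; exists k.
Qed.

Lemma approx_cauchy b : metric_cauchy rho (u \o approx b).
Proof.
move=> e e0; have [|k ke] := @half_small (e / 16); first by rewrite divr_gt0.
exists k => m n km kn /=.
have := approx_dist b k (m - k); have := approx_dist b k (n - k).
rewrite !subnKC// => h1 h2.
apply: le_lt_trans (metric_triangle (u (approx b k)) _ _) _.
by rewrite (metric_sym (u (approx b m))); lra.
Qed.

Lemma bits_limit_exists b : exists x, metric_converges rho (u \o approx b) x.
Proof. by case: rho_polish => _ h _; exact: h (approx_cauchy b). Qed.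

(** Every array of bits gets a limit, including those that describe no point, so any real number can
    be decoded. *)
Definition bits_limit b : S := projT1 (cid (bits_limit_exists b)).

Lemma bits_limit_dist b k : rho (u (approx b k)) (bits_limit b) <= 4 * 2^-1 ^+ k.
Proof.
rewrite /bits_limit; case: cid => x /= bx; apply/ler_addgt0Pr => e e0.
have [N /(_ (k + N)%N)] := bx e e0; rewrite leq_addl => /(_ isT) /= h.
apply: le_trans (metric_triangle (u (approx b (k + N))) _ _) _.
by apply: lerD; [exact: approx_dist|exact: ltW].
Qed.

(** On the bits of an actual point the guard never rejects: the old and new centres are within
    [2^-k + 2^-(k+1)], which is less than [2 * 2^-k]. *)
Lemma approx_ball_bits x k : rho x (u (approx (ball_bits x) k)) < 2^-1 ^+ k.
Proof.
have hl l : rho x (u (least (fun j => ball_bits x (l, j)))) < 2^-1 ^+ l.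
  by apply: (@leastP (fun j => ball_bits x (l, j))); exact: u_dense.
elim: k => [|k ih]; first exact: hl.
rewrite /=; case: ifPn => [_|/negP[]]; first exact: hl.
apply: le_lt_trans (metric_triangle x _ _) _; rewrite (metric_sym _ x).
have := hl k.+1; rewrite exprS; have := half_gt0 k.
by move: ih; lra.
Qed.

Lemma ball_bitsK x : bits_limit (ball_bits x) = x.
Proof.
apply/esym/metric_eq => e e0.
have [|k ke] := @half_small (e / 5); first by rewrite divr_gt0.
apply: le_trans (metric_triangle (u (approx (ball_bits x) k)) _ _) _.
have := approx_ball_bits x k; have := bits_limit_dist (ball_bits x) k.
by lra.
Qed.

(** The limit lies in an open [U] exactly when, for some [k], the closed ball of radius [4 * 2^-k]
    about the [k]-th approximation lies in [U]. This condition depends on an integer only, so the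
    event is a countable union. *)
Lemma random_var_bits_limit (d : measure_display) (T : measurableType d)
    (b : T -> nat * nat -> bool) : (forall i, measurable [set t | b t i]) ->
  random_var rho (fun t => bits_limit (b t)).
Proof.
move=> mb; apply: random_var_open => U oU.
have ma k n : measurable [set t | approx (b t) k = n].
  elim: k n => [|k ih] n /=; first exact: measurable_least.
  apply: (@measurable_nat_comp2 _ _ (fun a j =>
    if rho (u a) (u j) < 2 * 2^-1 ^+ k then j else a)) => // m.
  exact: measurable_least.
pose V k := [set n | forall y, rho (u n) y <= 4 * 2^-1 ^+ k -> U y].
rewrite (_ : _ @^-1` _ = \bigcup_k [set t | V k (approx (b t) k)]).
  by apply: bigcup_measurable => k _; exact: measurable_nat_preimage.
apply/seteqP; split => [t /= Ut|t [k _ /=]]; last first.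
  by apply; exact: bits_limit_dist.
have [e e0 eU] := oU _ Ut.
have [|k ke] := @half_small (e / 16); first by rewrite divr_gt0.
exists k => // y yk; apply: eU.
apply: le_lt_trans (metric_triangle (u (approx (b t) k)) _ _) _.
have := bits_limit_dist (b t) k; rewrite (metric_sym (bits_limit _)).
by move: yk; lra.
Qed.

End polish_coding.

(** Packs [S] with its Borel sets as a measurable type, so that [measurable_code] applies; [y0]
    provides the required point. *)
Lemma borel_code (R : realType) (I : countType) (S : Type) (rho : S -> S -> R)
    (y0 : S) (p : S -> nat -> bool) (b : S -> I -> bool) (B : set R) :
  (forall j, borel_sets rho [set y | p y j]) ->
  (forall i, borel_sets rho [set y | b y i]) -> measurable B ->
  borel_sets rho ((fun y => code R (least (p y)) (b y)) @^-1` B).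
Proof.
move=> mp mb mB.
pose S' : pointedType := HB.pack S (gen_eqMixin S) (gen_choiceMixin S)
  (isPointed.Build S y0).
pose T : measurableType _ := g_sigma_algebraType (metric_open rho : set (set S')).
have mN n : measurable [set y : T | least (p y) = n].
  by apply: (@measurable_least _ T).
have := @measurable_code R I _ T (fun y => least (p y)) b mN mb measurableT B mB.
by rewrite setTI.
Qed.

(** * Construction of the coupled variable *)

Theorem theorem12 (R : realType) (d : measure_display) (Omega : measurableType d)
  (P : probability Omega R) (S1 S2 : Type)
  (rho1 : S1 -> S1 -> R) (rho2 : S2 -> S2 -> R)
  (X : Omega -> S1) (Y : Omega -> S2) :
  polish rho1 -> polish rho2 ->
  random_var rho1 X -> random_var rho2 Y ->
  atomless_law P Y ->
  forall eps : R, 0 < eps ->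
  exists Z : Omega -> S2,
    [/\ random_var rho2 Z,
        same_law P rho2 Z Y,
        {ae P, forall w, rho2 (Y w) (Z w) <= eps} &
        exists f : S2 -> S1,
          borel_fun rho2 rho1 f /\ {ae P, forall w, X w = f (Z w)}].
Proof.
move=> pol1 pol2 mX mY Y0 eps eps0.
have [u1 u1P] := dense_sequence pol1 (X point).
have [u2 u2P] := dense_sequence pol2 (Y point).
(* Radius [eps / 2] puts two points of one cell within [eps] of each other, through the common
   centre. *)
pose near_pt y j := rho2 y (u2 j) < eps / 2.
pose cell y := least (near_pt y).
have cellP y : rho2 y (u2 (cell y)) < eps / 2.
  by apply: (@leastP (near_pt y)); apply: u2P; rewrite divr_gt0.
(* The tag [true] carries the bits of [X] and [false] those of [Y]: [k] will recover [X] from the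
   joint code, and [k'] will recover [Y]. *)
pose bits w (i : bool * (nat * nat)) : bool :=
  if i.1 then ball_bits rho1 u1 (X w) i.2 else ball_bits rho2 u2 (Y w) i.2.
pose psi y := code R (cell y) (ball_bits rho2 u2 y).
pose h (r : R) := bits_limit pol2 u2 (decode r).
pose k (r : R) := bits_limit pol1 u1 (fun i => decode r (true, i)).
pose k' (r : R) := bits_limit pol2 u2 (fun i => decode r (false, i)).
have hK y : h (psi y) = y by rewrite /h /psi codeK; exact: ball_bitsK.
have borel_psi B : measurable B -> borel_sets rho2 (psi @^-1` B).
  apply: borel_code => [|j|i]; [exact: (Y point)| |];
    by apply: sub_sigma_algebra; exact: metric_open_ball.
have rh : random_var rho2 h.
  by apply: random_var_bits_limit => i; exact: measurable_decode.
have rk : random_var rho1 k.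
  by apply: random_var_bits_limit => i; exact: measurable_decode.
have mW : measurable_fun setT (psi \o Y).
  by move=> _ B mB; rewrite setTI comp_preimage; exact: (mY _ (borel_psi _ mB)).
pose v w := code R (cell (Y w)) (bits w).
have kK w : k (v w) = X w.
  by rewrite /k /v codeK; exact: ball_bitsK.
have k'K w : k' (v w) = Y w.
  by rewrite /k' /v codeK; exact: ball_bitsK.
have mV : measurable_fun setT v.
  apply: measurable_code => [n|[[] i]].
  - apply: (@measurable_least _ _ (near_pt \o Y)) => j.
    apply: (mY [set y | near_pt y j]).
    by apply: sub_sigma_algebra; exact: metric_open_ball.
  - apply: (mX [set x | ball_bits rho1 u1 x i]).
    by apply: sub_sigma_algebra; exact: metric_open_ball.
  - apply: (mY [set y | ball_bits rho2 u2 y i]).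
    by apply: sub_sigma_algebra; exact: metric_open_ball.
pose W : {RV P >-> R} := HB.pack (psi \o Y)
  (isMeasurableFun.Build _ _ _ _ (psi \o Y) mW).
pose V : {RV P >-> R} := HB.pack v (isMeasurableFun.Build _ _ _ _ v mV).
(* A variable that determines [Y] has no atoms, since [U = r] forces [Y = g r], a null event. *)
have atomless (U : {RV P >-> R}) g : (forall w, g (U w) = Y w) -> atomless_RV U.
  move=> gU r; apply/eqP; rewrite eq_le measure_ge0 andbT -(Y0 (g r)).
  apply: le_measure; rewrite ?inE.
  - by apply: measurable_funPTI; exact: measurable_set1.
  - by apply: mY; exact: borel_set1.
  - by move=> w /= <-.
have W0 : atomless_RV W by apply: (atomless W h) => w; exact: hK.
have V0 : atomless_RV V by apply: (atomless V k') => w; exact: k'K.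
pose W' := transport V W.
have mW' : measurable_fun setT W' by exact: transport_measurable.
have lawW' B : measurable B -> P (W' @^-1` B) = P (W @^-1` B).
  exact: transport_law.
(* The set where [psi (h r)] differs from [r] is Borel and is never hit by [W], hence almost never
   by [W'], which has the same law. *)
have psi_h : {ae P, forall w, psi (h (W' w)) = W' w}.
  pose E := [set r | psi (h r) == r].
  have mE : measurable E.
    have mph : measurable_fun setT (psi \o h).
      by move=> _ B mB; rewrite setTI comp_preimage; exact: (rh _ (borel_psi _ mB)).
    rewrite -[E in measurable E]setTI.
    have mEb : measurable_fun setT (fun r => psi (h r) == r).
      exact: measurable_fun_eqr.
    by apply: (mEb measurableT [set true]).
  exists (W' @^-1` (~` E)); split.
  - by rewrite -[E in measurable E]setTI; apply: mW' => //; exact: measurableC.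
  - rewrite lawW'; last exact: measurableC.
    rewrite (_ : _ @^-1` _ = set0) ?measure0//.
    apply/seteqP; split => // w; apply; apply/eqP.
    exact: congr1 (hK (Y w)).
  - by move=> w /= nw; exact/negP/eqP.
have cell_eq : {ae P, forall w, cell (h (W' w)) = cell (Y w)}.
  (* Both codes have index [cell (Y w)], so they compare alike with each integer; the transport then
     preserves these comparisons almost surely, and they determine the index. *)
  have cdf_nat n : Rcdf V n%:R = Rcdf W n%:R.
    have VE w : (V w <= n%:R) = (cell (Y w) < n)%N by exact: code_le.
    have WE w : (W w <= n%:R) = (cell (Y w) < n)%N by exact: code_le.
    apply: EFin_inj; rewrite !EFin_Rcdf; congr (P _).
    by apply/funext => w; rewrite /mkset VE WE.
  have := ae_foralln (fun n => transport_le V0 W0 (cdf_nat n)).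
  apply: filterS2 psi_h => w hw le_nat.
  have lt_cell n : (cell (h (W' w)) < n)%N = (cell (Y w) < n)%N.
    rewrite -(code_le R _ (ball_bits rho2 u2 (h (W' w)))) -/(psi _) hw.
    by rewrite le_nat code_le.
  by apply/eqP; rewrite eqn_leq -ltnS lt_cell ltnSn -ltnS -lt_cell ltnSn.
exists (h \o W'); split.
- move=> B /(rh B) mB; rewrite comp_preimage -[E in measurable E]setTI.
  exact: mW'.
- move=> B /(rh B) mB; rewrite comp_preimage lawW'//; congr (P _).
  by apply/seteqP; split => w /=; have /= -> := hK (Y w).
- apply: filterS cell_eq => w hw /=.
  have := cellP (Y w); have := cellP (h (W' w)); rewrite hw => h1 h2.
  apply: le_trans (metric_triangle pol2 (u2 (cell (Y w))) _ _) _.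
  by rewrite (metric_sym pol2 _ (h _)); lra.
(* Read from the right: [psi] turns [Z] back into [W'], the inverse transport recovers [V], and [k]
   extracts [X]. *)
- exists (k \o quantile V \o Rcdf W \o psi); split.
    move=> B /(rk B) mB; apply: (borel_psi ((k \o quantile V \o Rcdf W) @^-1` B)).
    have mq : measurable_fun setT (quantile V \o Rcdf W).
      apply: measurableT_comp; last exact: Rcdf_measurable.
      exact: quantile_measurable.
    by rewrite -[E in measurable E]setTI; exact: (mq measurableT _ mB).
  apply: filterS2 psi_h (transportK V0 W0) => w hw Vw.
  by rewrite /= hw -[LHS]kK; congr (k _); exact: esym Vw.
Qed.
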